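(* Let $s\in(\frac12,1)$, and let $\Omega\subset\mathbb R^N$ be an open set bounded in the $e_1$ direction, i.e. $\Omega\subset\{x:-M\le x_1\le M\}$ for some $M>0$. Let $u,w:\mathbb R^N\to\mathbb R$ be such that: $u$ is a subsolution and $w$ a supersolution at non-zero gradient points inside $\Omega$; $u\le w$ on $\mathbb R^N\setminus\Omega$; $u,w\in C^{0,2s-1}(\mathbb R^N)$; and $u$ or $w$ is uniformly monotone along $e_1$ away from $\partial\Omega$ for some exponent $\alpha<2$, meaning that there exist $\beta,h_0>0$ such that this function, call it $v$, satisfies $v(x)+\beta h^\alpha\le v(x+he_1)$ for all $x\in\Omega$ and $0<h<\min\{d(x,\partial\Omega),h_0\}$. Then $u\le w$ in $\Omega$.
   Context: $\phi\in C^{1,1}(x_0)$ means there are $p\in\mathbb R^N$, $M',\eta_0>0$ with $|\phi(x_0+x)-\phi(x_0)-p\cdot x|\le M'|x|^2$ for $|x|<\eta_0$; $\nabla\phi(x_0):=p$. For such $\phi$ with $\nabla\phi(x)\ne0$ and $v=\nabla\phi(x)/|\nabla\phi(x)|$, $\Delta^s_\infty\phi(x)=\int_0^\infty\frac{\phi(x+\eta v)+\phi(x-\eta v)-2\phi(x)}{\eta^{1+2s}}d\eta$. A function $u$ is a subsolution [supersolution] at non-zero gradient points in $\Omega$ if it is upper [lower] semicontinuous and for every $x_0\in\Omega$, whenever $r>0$, $\phi\in C^{1,1}(x_0)\cap C(\overline{B_r(x_0)})$ with $\nabla\phi(x_0)\ne0$, $\phi(x_0)=u(x_0)$ and $\phi>u$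 [$\phi<u$] on $B_r(x_0)\setminus\{x_0\}$, the function $\tilde u$ equal to $\phi$ on $B_r(x_0)$ and to $u$ elsewhere satisfies $\Delta^s_\infty\tilde u(x_0)\ge0$ [$\le0$]. $C^{0,\gamma}(\mathbb R^N)$: functions with $\sup_{x\ne y}|u(x)-u(y)|/|x-y|^\gamma<\infty$. *)

(* Defs.v *)
From HB Require Import structures.
From mathcomp Require Import all_boot all_order all_algebra.
From mathcomp Require Import all_classical all_reals all_analysis.
Set Implicit Arguments. Unset Strict Implicit. Unset Printing Implicit Defensive.
Import Order.TTheory GRing.Theory Num.Theory.
Local Open Scope classical_set_scope.
Local Open Scope ring_scope.

Section Defs.
Variables (R : realType) (N : nat).
Notation V := 'rV[R]_N.

Definition edot (p x : V) : R := \sum_(i < N) p ord0 i * x ord0 i.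
Definition enorm (x : V) : R := Num.sqrt (\sum_(i < N) (x ord0 i) ^+ 2).

Definition eball (x0 : V) (r : R) : set V := [set y | enorm (y - x0) < r].
Definition ecball (x0 : V) (r : R) : set V := [set y | enorm (y - x0) <= r].

Definition eopen (O : set V) : Prop :=
  forall x, O x -> exists2 r : R, 0 < r & eball x r `<=` O.

Definition eboundary (O : set V) : set V :=
  [set y | forall r : R, 0 < r ->
     (exists z, eball y r z /\ O z) /\ (exists z, eball y r z /\ ~ O z)].

Definition edist (x : V) (A : set V) : R := inf [set enorm (x - y) | y in A].

Definition C11_at (phi : V -> R) (x0 p : V) : Prop :=
  exists M' eta0 : R, 0 < M' /\ 0 < eta0 /\
    forall x : V, enorm x < eta0 ->
      `|phi (x0 + x) - phi x0 - edot p x| <= M' * enorm x ^+ 2.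

Definition continuous_on (phi : V -> R) (A : set V) : Prop :=
  forall y, A y -> forall eps : R, 0 < eps -> exists2 delta : R, 0 < delta &
    forall z, A z -> enorm (z - y) < delta -> `|phi z - phi y| < eps.

Definition usc (u : V -> R) : Prop :=
  forall x (eps : R), 0 < eps -> exists2 delta : R, 0 < delta &
    forall y, enorm (y - x) < delta -> u y < u x + eps.

Definition lsc (u : V -> R) : Prop :=
  forall x (eps : R), 0 < eps -> exists2 delta : R, 0 < delta &
    forall y, enorm (y - x) < delta -> u x - eps < u y.

(* Delta^s_infty f (x) computed in the unit direction v (v = grad f(x)/|grad f(x)|),
   as a Lebesgue integral over ]0, +oo[ (extended-real valued). *)
Definition frac_inf_lap (s : R) (f : V -> R) (x v : V) : \bar R :=
  (\int[lebesgue_measure]_(eta in [set eta : R | (0 < eta)%R])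
     ((f (x + eta *: v) + f (x - eta *: v) - 2 * f x) / powR eta (1 + 2 * s))%R%:E)%E.

Definition glue (u phi : V -> R) (x0 : V) (r : R) : V -> R :=
  fun y => if enorm (y - x0) < r then phi y else u y.

Definition subsol_nzgrad (s : R) (O : set V) (u : V -> R) : Prop :=
  usc u /\
  forall x0, O x0 -> forall (r : R) (phi : V -> R) (p : V),
    0 < r -> C11_at phi x0 p -> continuous_on phi (ecball x0 r) ->
    p != 0 -> phi x0 = u x0 ->
    (forall y, eball x0 r y -> y != x0 -> phi y > u y) ->
    (0 <= frac_inf_lap s (glue u phi x0 r) x0 ((enorm p)^-1 *: p))%E.

Definition supersol_nzgrad (s : R) (O : set V) (u : V -> R) : Prop :=
  lsc u /\
  forall x0, O x0 -> forall (r : R) (phi : V -> R) (p : V),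
    0 < r -> C11_at phi x0 p -> continuous_on phi (ecball x0 r) ->
    p != 0 -> phi x0 = u x0 ->
    (forall y, eball x0 r y -> y != x0 -> phi y < u y) ->
    (frac_inf_lap s (glue u phi x0 r) x0 ((enorm p)^-1 *: p) <= 0)%E.

Definition holder (gamma : R) (u : V -> R) : Prop :=
  exists C : R, forall x y : V, x != y ->
    `|u x - u y| / powR (enorm (x - y)) gamma <= C.

End Defs.

Definition e1 (R : realType) (N : nat) (hN : (0 < N)%N) : 'rV[R]_N :=
  \row_(j < N) (if val j == 0%N then 1 else 0).

Definition unif_monotone (R : realType) (N : nat) (hN : (0 < N)%N)
    (O : set 'rV[R]_N) (alpha : R) (v : 'rV[R]_N -> R) : Prop :=
  exists beta h0 : R, 0 < beta /\ 0 < h0 /\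
    forall x h, O x -> 0 < h -> h < Num.min (edist x (eboundary O)) h0 ->
      v x + beta * powR h alpha <= v (x + h *: e1 R hN).

(* Main.v *)
(* Doubling of variables. If [u > w] somewhere, maximise
   [u x - w y - k |x - y|^2] for a large [k]. As [Omega] may be unbounded the maximum
   need not be attained; a penalisation of size [theta], centred at a near-maximum,
   produces a maximum point [(xs, ys)], and both points lie well inside [Omega]. Exact
   quadratics then touch [u] from above at [xs] and [w] from below at [ys], with
   gradients [p], [q] such that [|p - q| <= 4 theta].

   Uniform monotonicity with exponent [alpha < 2] beats the quadratic error, so the
   first coordinates of [p] and [q] are bounded below by a constant depending on [k]
   but not on [theta]: the gradients do not vanish, their directions agree up to
   [O(theta)], and the ray from [xs] along [p] leaves the strip after a bounded time,
   where [u <= w].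

   The maximum property for simultaneous shifts of [xs] and [ys] bounds the difference
   of the two viscosity integrals: the part [t < rho] is [O(rho^(2 - 2s))], the part
   [t >= rho] tends to [0] with [theta] (by the [C^(0,2s-1)] bound the tail is
   [O(t^-2)]), and the part outside the strip contributes a fixed negative amount.
   Choosing [rho], then [theta], small contradicts the viscosity inequalities. *)
Require Import Defs.
From HB Require Import structures.
From mathcomp Require Import all_boot all_order all_algebra.
From mathcomp Require Import all_classical all_reals all_analysis.
From mathcomp Require Import measurable_realfun ring lra.
Set Implicit Arguments.
Unset Strict Implicit.
Unset Printing Implicit Defensive.
Import Order.TTheory GRing.Theory Num.Theory.
Import numFieldNormedType.Exports.
Local Open Scope classical_set_scope.
Local Open Scope ring_scope.

(** * Euclidean inner product and norm on row vectors *)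

Section Euclidean.
Variables (R : realType) (N : nat).
Implicit Types (x y z p : 'rV[R]_N) (a : R).

Lemma edotC x y : edot x y = edot y x.
Proof. by apply: eq_bigr => i _; rewrite mulrC. Qed.

Lemma edotDl x y z : edot (x + y) z = edot x z + edot y z.
Proof. by rewrite -big_split; apply: eq_bigr => i _; rewrite mxE mulrDl. Qed.

Lemma edotZl a x y : edot (a *: x) y = a * edot x y.
Proof. by rewrite /edot mulr_sumr; apply: eq_bigr => i _; rewrite mxE mulrA. Qed.

Lemma edotNl x y : edot (- x) y = - edot x y.
Proof. by rewrite -scaleN1r edotZl mulN1r. Qed.

Lemma edotDr x y z : edot z (x + y) = edot z x + edot z y.
Proof. by rewrite edotC edotDl !(edotC _ z). Qed.

Lemma edotZr a x y : edot x (a *: y) = a * edot x y.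
Proof. by rewrite edotC edotZl edotC. Qed.

Lemma edotNr x y : edot x (- y) = - edot x y.
Proof. by rewrite edotC edotNl edotC. Qed.

Definition edotE := (edotDl, edotDr, edotNl, edotNr, edotZl, edotZr).

Lemma edot_ge0 x : 0 <= edot x x.
Proof. by apply: sumr_ge0 => i _; rewrite -expr2 sqr_ge0. Qed.

Lemma enorm_ge0 x : 0 <= enorm x.
Proof. exact: sqrtr_ge0. Qed.

Lemma enorm_sqr x : enorm x ^+ 2 = edot x x.
Proof.
rewrite sqr_sqrtr; first by apply: eq_bigr => i _; rewrite expr2.
by apply: sumr_ge0 => i _; rewrite sqr_ge0.
Qed.

Lemma enormE x : enorm x = Num.sqrt (edot x x).
Proof. by rewrite -enorm_sqr sqrtr_sqr ger0_norm// enorm_ge0. Qed.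

Lemma enormZ a x : enorm (a *: x) = `|a| * enorm x.
Proof.
by rewrite !enormE !edotE mulrA -expr2 sqrtrM ?sqr_ge0// sqrtr_sqr.
Qed.

Lemma enormN x : enorm (- x) = enorm x.
Proof. by rewrite -scaleN1r enormZ normrN1 mul1r. Qed.

Lemma enormB x y : enorm (x - y) = enorm (y - x).
Proof. by rewrite -enormN opprB. Qed.

Lemma enorm0 : enorm (0 : 'rV[R]_N) = 0.
Proof. by rewrite -(scale0r 0) enormZ normr0 mul0r. Qed.

Lemma le_coord_enorm x i : `|x ord0 i| <= enorm x.
Proof.
rewrite -(ler_sqr (normr_ge0 _) (enorm_ge0 x)) enorm_sqr real_normK ?num_real//.
rewrite /edot (bigD1 i)//= -expr2 lerDl.
by apply: sumr_ge0 => j _; rewrite -expr2 sqr_ge0.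
Qed.

Lemma enorm_eq0 x : (enorm x == 0) = (x == 0).
Proof.
apply/eqP/eqP => [x0|->]; last exact: enorm0.
apply/rowP => i; rewrite mxE; apply/eqP; rewrite -normr_le0.
by have := le_coord_enorm x i; rewrite x0.
Qed.

Lemma enorm_gt0 x : (0 < enorm x) = (x != 0).
Proof. by rewrite lt_def enorm_ge0 andbT enorm_eq0. Qed.

(** Cauchy-Schwarz: for nonzero vectors, expand the squared norm of
    [enorm y *: x - enorm x *: y]. *)
Lemma edot_le_enorm x y : edot x y <= enorm x * enorm y.
Proof.
have [->|x0] := eqVneq x 0.
  by rewrite -(scale0r 0) edotZl enormZ normr0 !mul0r.
have [->|y0] := eqVneq y 0.
  by rewrite -(scale0r 0) edotZr enormZ normr0 !mul0r mulr0.
have := edot_ge0 (enorm y *: x - enorm x *: y).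
rewrite !edotE -!enorm_sqr (edotC y x).
move: x0 y0; rewrite -!enorm_gt0; move: (enorm x) (enorm y) (edot x y) => a b c.
move=> a0 b0; have ab0 : 0 < a * b by rewrite mulr_gt0.
rewrite [X in 0 <= X](_ : _ = 2 * (a * b) * (a * b - c)); last by ring.
by rewrite pmulr_rge0 ?subr_ge0// mulr_gt0.
Qed.

Lemma ler_enormD x y : enorm (x + y) <= enorm x + enorm y.
Proof.
rewrite -ler_sqr ?nnegrE ?addr_ge0 ?enorm_ge0// enorm_sqr !edotE (edotC y x).
have := edot_le_enorm x y; rewrite sqrrD !enorm_sqr; lra.
Qed.

Lemma ler_enorm_tri z x y : enorm (x - y) <= enorm (x - z) + enorm (z - y).
Proof. by rewrite -[x in enorm (x - y)](subrK z) -addrA ler_enormD. Qed.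

Lemma enorm_normalize p : p != 0 -> enorm ((enorm p)^-1 *: p) = 1.
Proof.
rewrite -enorm_gt0 => p0.
by rewrite enormZ ger0_norm ?invr_ge0 ?enorm_ge0// mulVf// gt_eqF.
Qed.

(** Up to the factor 1/|p|, the difference is p - q plus (|q| - |p|) q/|q|; both terms have norm at
    most |p - q|. *)
Lemma enorm_normalizeB p q : p != 0 -> q != 0 ->
  enorm ((enorm p)^-1 *: p - (enorm q)^-1 *: q) <= 2 * enorm (p - q) / enorm p.
Proof.
move=> p0 q0; have := p0; have := q0; rewrite -!enorm_gt0 => nq np.
have -> : (enorm p)^-1 *: p - (enorm q)^-1 *: q =
    (enorm p)^-1 *: ((p - q) + (enorm q - enorm p) *: ((enorm q)^-1 *: q)).
  rewrite scalerDr scalerBr !scalerA mulrBr mulVf ?gt_eqF//.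
  rewrite mulrBl mul1r -mulrA divff ?gt_eqF// mulr1 scalerBl.
  by rewrite addrA subrK.
rewrite enormZ ger0_norm ?invr_ge0 ?enorm_ge0// mulrC.
rewrite ler_pM2r ?invr_gt0//.
apply: le_trans (ler_enormD _ _) _.
rewrite enormZ enorm_normalize// mulr1 mulrDl !mul1r lerD2l.
have := ler_enorm_tri p q 0; have := ler_enorm_tri q p 0.
rewrite !subr0 (enormB q p) ler_norml; lra.
Qed.

Lemma edot_e1 (hN : (0 < N)%N) p : edot p (e1 R hN) = p ord0 (Ordinal hN).
Proof.
rewrite /edot (bigD1 (Ordinal hN))//= mxE/= mulr1 big1 ?addr0// => i iN.
rewrite mxE ifF ?mulr0//; apply: contraNF iN => /eqP i0.
exact/eqP/val_inj.
Qed.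

Lemma enorm_e1 (hN : (0 < N)%N) : enorm (e1 R hN) = 1.
Proof. by rewrite enormE edot_e1 mxE/= sqrtr1. Qed.

End Euclidean.

(** * Integrals of powers over intervals and half-lines *)

Section PowerIntegrals.
Variable R : realType.
Notation mu := (@lebesgue_measure R).

Lemma continuous_powR (a x : R) : 0 < x -> {for x, continuous (@powR R ^~ a)}.
Proof.
move=> x0; apply: differentiable_continuous; apply/derivable1_diffP.
by apply: derivable_powR; rewrite in_itv/= x0.
Qed.

Lemma integral_powR_itvcc (a x y : R) : a + 1 != 0 -> 0 < x -> x < y ->
  (\int[mu]_(t in `[x, y]) (t `^ a)%:E =
   ((y `^ (a + 1) - x `^ (a + 1)) / (a + 1))%:E)%E.
Proof.
move=> a1 x0 xy.
pose F := fun t : R => t `^ (a + 1) / (a + 1).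
have cF (t : R) : 0 < t -> {for t, continuous F}.
  move=> t0; apply: continuousM; [exact: continuous_powR|exact: cst_continuous].
have dF (t : R) : 0 < t -> is_derive t 1 F (t `^ a).
  move=> t0; have d := is_derive1_powR (a + 1) t0.
  have -> : F = (a + 1)^-1 \*: (@powR R ^~ (a + 1) : R -> R^o).
    by apply/funext => z /=; rewrite /F mulrC.
  apply: (is_derive_eq (is_deriveZ (a + 1)^-1 d)).
  by rewrite /GRing.scale/= mulrA mulVf// mul1r addrK.
rewrite (@continuous_FTC2 _ _ F)//.
- by rewrite -EFinB mulrBl.
- apply: continuous_in_subspaceT => t; rewrite inE/= in_itv/= => /andP[xt _].
  exact/continuous_powR/(lt_le_trans x0).
- split.
  + move=> t; rewrite in_itv/= => /andP[xt _].
    by have [] := dF t (lt_trans x0 xt).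
  + by apply/cvg_at_right_filter; exact: cF.
  + by apply/cvg_at_left_filter; apply: cF; exact: lt_trans xy.
- move=> t; rewrite in_itv/= => /andP[xt _].
  by rewrite derive1E; have := dF t (lt_trans x0 xt) => /@derive_val.
Qed.

(** Monotone convergence: carries uniform bounds over compact intervals to improper integrals. *)
Lemma integral_bigcup_le (f : R -> R) (F : (set R)^nat) (B : R) :
  measurable_fun setT f -> (forall x, 0 <= f x) ->
  nondecreasing_seq F -> (forall i, measurable (F i)) ->
  (forall i, \int[mu]_(x in F i) (f x)%:E <= B%:E)%E ->
  (\int[mu]_(x in \bigcup_i F i) (f x)%:E <= B%:E)%E.
Proof.
move=> mf f0 ndF mF FB.
have h := @ge0_nondecreasing_set_cvg_integral _ (measurableTypeR R) R F
  (EFin \o f) lebesgue_measure ndF mF.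
apply: (@cvge_le _ _ _ _ _ _ _ _ (h _ _)).
- exact: nearW.
- move=> i; apply/measurable_EFinP; exact: measurable_funTS.
- by move=> i x _; rewrite lee_fin.
Qed.

(** As a + 1 > 0, the primitive at the lower endpoint enters with a minus sign and is dropped. *)
Lemma integral_powR_head (a rho : R) : - 1 < a -> 0 < rho ->
  (\int[mu]_(t in `]0%R, rho[) (t `^ a)%:E <=
   (rho `^ (a + 1) / (a + 1))%:E)%E.
Proof.
move=> a1 rho0; have a10 : 0 < a + 1 by lra.
(* [n.+2] keeps the left endpoint strictly below [rho] already for [n = 0]. *)
pose F (n : nat) : set R := `[rho / n.+2%:R, rho]%classic.
have FE : `]0, rho[%classic `<=` \bigcup_n F n.
  move=> t /=; rewrite in_itv/= => /andP[t0 trho].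
  have [n _ nt] := @near_infty_natSinv_lt R (PosNum (divr_gt0 t0 rho0)).
  exists n => //; rewrite /F/= in_itv/= (ltW trho) andbT.
  rewrite ler_pdivrMr// mulrC -ler_pdivrMr//.
  have := nt n (leqnn n) => /=; rewrite invf_plt ?posrE ?divr_gt0// invf_div => h.
  by apply: (le_trans (ltW h)); rewrite ler_nat.
apply: (@le_trans _ _ (\int[mu]_(t in \bigcup_n F n) (t `^ a)%:E)%E).
  apply: ge0_subset_integral => //=.
  - by apply: bigcup_measurable => n _; exact: measurable_itv.
  - apply/measurable_EFinP; apply: measurable_funTS; exact: measurable_powR.
  - by move=> x _; rewrite lee_fin powR_ge0.
apply: integral_bigcup_le.
- exact: measurable_powR.
- by move=> x; exact: powR_ge0.
- apply/nondecreasing_seqP => n; apply/subsetPset => t; rewrite /F/= !in_itv/=.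
  move=> /andP[+ ->]; rewrite andbT; apply: le_trans.
  by rewrite ler_pM2l// lef_pV2 ?posrE// ler_nat.
- by move=> n; exact: measurable_itv.
- move=> n; rewrite integral_powR_itvcc ?gt_eqF ?divr_gt0//; last first.
    by rewrite ltr_pdivrMr// ltr_pMr// ltr1n.
  by rewrite lee_fin ler_pM2r ?invr_gt0// gerBl powR_ge0.
Qed.

(** Here a + 1 < 0, so the term dropped is the one at the upper endpoint. *)
Lemma integral_powR_tail (a rho : R) : a < - 1 -> 0 < rho ->
  (\int[mu]_(t in `[rho, +oo[) (t `^ a)%:E <=
   (rho `^ (a + 1) / - (a + 1))%:E)%E.
Proof.
move=> a1 rho0; have a10 : 0 < - (a + 1) by lra.
pose F (n : nat) : set R := `[rho, rho + n.+1%:R]%classic.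
have FE : `[rho, +oo[%classic `<=` \bigcup_n F n.
  move=> t /=; rewrite in_itv/= andbT => rhot.
  have [n tn] : exists n : nat, t <= n%:R.
    by exists (Num.truncn t).+1; exact/ltW/truncnS_gt.
  exists n => //; rewrite /F/= in_itv/= rhot /=.
  by rewrite (le_trans tn)// (@le_trans _ _ n.+1%:R) ?ler_nat ?lerDr// ltW.
apply: (@le_trans _ _ (\int[mu]_(t in \bigcup_n F n) (t `^ a)%:E)%E).
  apply: ge0_subset_integral => //=.
  - by apply: bigcup_measurable => n _; exact: measurable_itv.
  - apply/measurable_EFinP; apply: measurable_funTS; exact: measurable_powR.
  - by move=> x _; rewrite lee_fin powR_ge0.
apply: integral_bigcup_le.
- exact: measurable_powR.
- by move=> x; exact: powR_ge0.
- apply/nondecreasing_seqP => n; apply/subsetPset => t; rewrite /F/= !in_itv/=.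
  move=> /andP[-> h] /=; apply: (le_trans h).
  by rewrite lerD2l ler_nat.
- by move=> n; exact: measurable_itv.
- move=> n; rewrite integral_powR_itvcc ?ltrDl//; last first.
    by rewrite -oppr_eq0 gt_eqF.
  rewrite lee_fin -mulrNN -invrN ler_pM2r ?invr_gt0// opprB gerBl powR_ge0//.
Qed.


Notation pos := [set t : R | 0 < t].

Lemma pos_itv : pos = `]0, +oo[%classic.
Proof. by apply/seteqP; split => t /=; rewrite in_itv/= andbT. Qed.

Lemma measurable_pos : measurable (pos : set (measurableTypeR R)).
Proof. by rewrite pos_itv; exact: measurable_itv. Qed.

Lemma pos_split (rho : R) : 0 < rho ->
  pos = `]0, rho[%classic `|` `[rho, +oo[%classic.
Proof.
move=> rho0; apply/seteqP; split => t /=; rewrite !in_itv/= ?andbT.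
  by move=> ->/=; have [?|?] := ltP t rho; [left|right].
by move=> [/andP[]//|]; exact: lt_le_trans.
Qed.

(** Majorant for the Laplacian integrands: one power near the origin, another in the tail. *)
Definition two_powers (a b rho A B : R) (t : R) : R :=
  if t < rho then A * t `^ a else B * t `^ b.

Section TwoPowers.
Variables (a b rho A B : R).
Hypotheses (a1 : - 1 < a) (b1 : b < - 1) (rho0 : 0 < rho).
Hypotheses (A0 : 0 <= A) (B0 : 0 <= B).
Notation G := (two_powers a b rho A B).

Lemma two_powers_ge0 t : 0 <= G t.
Proof. by rewrite /two_powers; case: ifP => _; rewrite mulr_ge0 ?powR_ge0. Qed.

Lemma measurable_two_powers : measurable_fun setT G.
Proof.
apply: measurable_fun_ifT.
- exact: measurable_fun_ltr.
- by apply: measurable_funM => //; exact: measurable_powR.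
- by apply: measurable_funM => //; exact: measurable_powR.
Qed.

Lemma integral_two_powers :
  (\int[mu]_(t in pos) (G t)%:E <=
   (A * (rho `^ (a + 1) / (a + 1)) + B * (rho `^ (b + 1) / - (b + 1)))%:E)%E.
Proof.
rewrite (pos_split rho0) ge0_integral_setU//=; last 3 first.
- by apply/measurable_EFinP; apply: measurable_funTS; exact: measurable_two_powers.
- by move=> t _; rewrite lee_fin two_powers_ge0.
- apply/disj_setPS => t /=; rewrite !in_itv/= andbT => -[/andP[_ h1] h2].
  by move: (lt_le_trans h1 h2); rewrite ltxx.
rewrite EFinD; apply: leeD.
- rewrite [leLHS](_ : _ =
      \int[mu]_(t in `]0%R, rho[) (A%:E * (t `^ a)%:E))%E; last first.
    apply: eq_integral => t; rewrite inE/= in_itv/= => /andP[_ t1].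
    by rewrite /two_powers t1 EFinM.
  rewrite ge0_integralZl//=.
  + rewrite EFinM lee_wpmul2l ?lee_fin//; exact: integral_powR_head.
  + by apply/measurable_EFinP; apply: measurable_funTS; exact: measurable_powR.
  + by move=> t _; rewrite lee_fin powR_ge0.
- rewrite [leLHS](_ : _ =
      \int[mu]_(t in `[rho, +oo[) (B%:E * (t `^ b)%:E))%E; last first.
    apply: eq_integral => t; rewrite inE/= in_itv/= andbT => t1.
    by rewrite /two_powers ltNge t1 EFinM.
  rewrite ge0_integralZl//=.
  + rewrite EFinM lee_wpmul2l ?lee_fin//; exact: integral_powR_tail.
  + by apply/measurable_EFinP; apply: measurable_funTS; exact: measurable_powR.
  + by move=> t _; rewrite lee_fin powR_ge0.
Qed.

Lemma integrable_two_powers : mu.-integrable pos (EFin \o G).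
Proof.
apply/integrableP; split.
  by apply/measurable_EFinP; apply: measurable_funTS; exact: measurable_two_powers.
under eq_integral => t _ do rewrite /= ger0_norm ?two_powers_ge0//.
by apply: le_lt_trans integral_two_powers _; rewrite ltry.
Qed.

Lemma le_two_powers_integrable (F : R -> R) : measurable_fun pos F ->
  (forall t, 0 < t -> `|F t| <= G t) -> mu.-integrable pos (EFin \o F).
Proof.
move=> mF FG; apply: le_integrable integrable_two_powers.
- exact: measurable_pos.
- exact/measurable_EFinP.
- by move=> t /FG h; rewrite lee_fin (le_trans h)// ler_norm.
Qed.

(** Subtract from the majorant [m] times the indicator of the unit interval [[L, L + 1]], whose
    integral is exactly [m]. *)
Lemma integral_le_two_powers_gap (F : R -> R) (L m : R) :
  mu.-integrable pos (EFin \o F) -> 0 < L ->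
  (forall t, 0 < t -> F t <= G t) ->
  (forall t, L <= t <= L + 1 -> F t <= G t - m) ->
  (\int[mu]_(t in pos) (F t)%:E <=
   (A * (rho `^ (a + 1) / (a + 1)) + B * (rho `^ (b + 1) / - (b + 1)) - m)%:E)%E.
Proof.
move=> iF L0 FG FGm.
pose J := fun t : R => m * \1_(`[L, L + 1]%classic : set R) t.
have iI : mu.-integrable pos (EFin \o (\1_(`[L, L + 1]%classic : set R) : R -> R)).
  apply: (integrableS measurableT measurable_pos) => //.
  exact: integrable_indic_itv.
have iJ : mu.-integrable pos (EFin \o J).
  exact: (integrableZl measurable_pos m iI).
have IJ : (\int[mu]_(t in pos) (J t)%:E = m%:E)%E.
  rewrite (integralZl measurable_pos iI) integral_indic//; last exact: measurable_pos.
  rewrite setIidl; last first.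
    by move=> t /=; rewrite in_itv/= => /andP[+ _]; exact: lt_le_trans.
  rewrite /= lebesgue_measure_itv/= lte_fin ltrDl ltr01 -EFinB addrC addKr mule1//.
apply: (@le_trans _ _ (\int[mu]_(t in pos) ((G t)%:E - (J t)%:E))%E).
  apply: le_integral => //.
  - exact: measurable_pos.
  - exact: (integrableB measurable_pos integrable_two_powers iJ).
  - move=> t; rewrite inE/= => t0; rewrite lee_fin /J indicE.
    have [/set_mem/=|_] := boolP (t \in _).
    + by rewrite in_itv/= mulr1; exact: FGm.
    + by rewrite mulr0 subr0; exact: FG.
rewrite (integralB_EFin measurable_pos integrable_two_powers iJ) IJ.
by rewrite EFinB leeB// integral_two_powers.
Qed.

End TwoPowers.
End PowerIntegrals.

(** * Holder functions and smallness of powers *)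

Section HolderFunctions.
Variables (R : realType) (N : nat).
Notation V := 'rV[R]_N.

(** (e / C)^(1 / g) solves C t^g = e. *)
Lemma powR_small (C g e : R) : 0 < C -> 0 < g -> 0 < e ->
  exists2 d : R, 0 < d <= 1 & forall t, 0 <= t <= d -> C * t `^ g <= e.
Proof.
move=> C0 g0 e0; exists (Num.min 1 ((e / C) `^ g^-1)).
  by rewrite lt_min ltr01 powR_gt0 ?divr_gt0//= ge_min lexx.
move=> t /andP[t0]; rewrite le_min => /andP[_ td].
rewrite mulrC -ler_pdivlMr//.
have -> : e / C = ((e / C) `^ g^-1) `^ g.
  by rewrite -powRrM mulVf ?gt_eqF// powRr1// ltW// divr_gt0.
by apply: ge0_ler_powR; rewrite ?nnegrE ?powR_ge0// ltW.
Qed.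

(** On the diagonal both sides vanish, because 0^g = 0 for g > 0. The maximum with 1 makes the
    constant positive. *)
Lemma holder_bound (g : R) (u : V -> R) : 0 < g -> holder g u ->
  exists2 C, 0 < C & forall x y, `|u x - u y| <= C * enorm (x - y) `^ g.
Proof.
move=> g0 [C uC]; exists (Num.max C 1); first by rewrite lt_max ltr01 orbT.
move=> x y; have [->|xy] := eqVneq x y.
  by rewrite !subrr normr0 enorm0 powR0 ?gt_eqF// mulr0.
have p0 : 0 < enorm (x - y) `^ g by rewrite powR_gt0// enorm_gt0 subr_eq0.
by have := uC x y xy; rewrite ler_pdivrMr// => /le_trans; apply;
  rewrite ler_pM2r// le_max lexx.
Qed.

Lemma edot_sqr_continuous : continuous (fun x : V => edot x x).
Proof.
rewrite /edot; apply: continuous_big => [xy|i _ x]; first exact: add_continuous.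
by apply: continuousM; exact: coord_continuous.
Qed.

Lemma enorm_continuous : continuous (@enorm R N).
Proof.
move=> x; rewrite (_ : @enorm R N = Num.sqrt \o (fun x : V => edot x x)).
  by apply: continuous_comp; [exact: edot_sqr_continuous|exact: sqrt_continuous].
by apply/funext => z /=; rewrite enormE.
Qed.

Variables (g C : R) (u : V -> R).
Hypotheses (g0 : 0 < g) (C0 : 0 < C).
Hypothesis uC : forall x y, `|u x - u y| <= C * enorm (x - y) `^ g.

Lemma holder_continuous : continuous u.
Proof.
move=> x; apply/(@cvgrPdist_le _ _ _ (nbhs x)) => e e0.
have [d /andP[d0 _] dC] := powR_small C0 g0 e0.
have cx : {for x, continuous (fun y : V => enorm (x - y))}.
  apply: continuous_comp; last exact: enorm_continuous.
  by apply: continuousB => //; exact: cst_continuous.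
have /(@cvgrPdist_le _ _ _ (nbhs x))/(_ d d0) := cx.
rewrite subrr enorm0; apply: filterS => y /=.
rewrite sub0r normrN ger0_norm ?enorm_ge0// => yd.
by apply: le_trans (uC _ _) _; apply: dC; rewrite enorm_ge0.
Qed.

Lemma line_continuous (x v : V) : continuous (fun t : R => u (x + t *: v)).
Proof.
move=> t; apply: (@continuous_comp R V R (fun t => x + t *: v) u).
  by apply: continuousD; [exact: cst_continuous|exact: scalel_continuous].
exact: holder_continuous.
Qed.

End HolderFunctions.

(** * Maxima after a small perturbation *)

Section PerturbedMaximum.
Variables (R : realType) (N : nat).
Notation V := 'rV[R]_N.

(** Boxes serve instead of balls: they are products of segments, and leaving one moves some
    coordinate by more than 1. *)
Lemma box_compact (x : V) :
  compact [set y : V | forall i, y ord0 i \in `[x ord0 i - 1, x ord0 i + 1]].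
Proof.
apply: (rV_compact (A := fun i => `[x ord0 i - 1, x ord0 i + 1]%classic)) => i.
exact: segment_compact.
Qed.

Lemma notin_box (x y : V) :
  ~ (forall i, y ord0 i \in `[x ord0 i - 1, x ord0 i + 1]) ->
  1 <= edot (y - x) (y - x).
Proof.
move=> /existsNP[i] /negP; rewrite in_itv/= => h.
have h1 : 1 < `|(y - x) ord0 i|.
  by rewrite !mxE ltNge ler_norml; apply: contra h => /andP[? ?]; lra.
by rewrite -enorm_sqr expr_ge1 ?enorm_ge0// (le_trans (ltW h1))// le_coord_enorm.
Qed.

(* A function bounded above need not attain its supremum on the whole space, but it
   does after subtracting a small truncated quadratic centred at a near-maximum. *)
Lemma perturbed_max (f : V * V -> R) (B theta : R) (z0 : V * V) :
  continuous f -> (forall z, f z <= B) -> 0 < theta ->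
  exists zb zs : V * V,
  let Q (z : V * V) := edot (z.1 - zb.1) (z.1 - zb.1) +
                       edot (z.2 - zb.2) (z.2 - zb.2) in
  [/\ f z0 - theta <= f zs, Q zs <= 1 &
      forall z, f z - theta * Num.min 1 (Q z) <= f zs - theta * Q zs].
Proof.
move=> cf fB th0.
have hs : has_sup (range f).
  by split; [exists (f z0), z0|exists B => _ [z _ <-]].
have th2 : 0 < theta / 2 by lra.
(* [zb] loses less than [theta / 2] against the supremum, half of the full penalty. *)
have [_ [zb _ <-] fzb] := sup_adherent th2 hs.
have supf z : f z <= sup (range f).
  by apply: ub_le_sup; [exact: hs.2|exists z].
pose Q (z : V * V) := edot (z.1 - zb.1) (z.1 - zb.1) +
                       edot (z.2 - zb.2) (z.2 - zb.2).
have Q0 z : 0 <= Q z by rewrite addr_ge0 ?edot_ge0.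
pose h z := f z - theta * Num.min 1 (Q z).
have cQ : continuous Q.
  have sqB (x : V) (p : V * V -> V) : continuous p ->
      continuous (fun z => edot (p z - x) (p z - x)).
    move=> cp z; apply: (@continuous_comp _ V R (fun z => p z - x)
      (fun x : V => edot x x)); last exact: edot_sqr_continuous.
    by apply: continuousB; [exact: cp|exact: cst_continuous].
  move=> z; apply: (@continuousD R R (V * V)%type).
    by apply: sqB => ?; exact: cvg_fst.
  by apply: sqB => ?; exact: cvg_snd.
have ch : continuous h.
  move=> z; apply: (@continuousB R R (V * V)%type); first exact: cf.
  apply: (@continuousM R (V * V)%type); first exact: cst_continuous.
  by apply: continuous_min; [exact: cst_continuous|exact: cQ].
pose K : set (V * V) :=
  [set y : V | forall i, y ord0 i \in `[zb.1 ord0 i - 1, zb.1 ord0 i + 1]] `*`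
  [set y : V | forall i, y ord0 i \in `[zb.2 ord0 i - 1, zb.2 ord0 i + 1]].
have Kzb : K zb by split => i /=; rewrite in_itv/=; apply/andP; split; lra.
have cK : compact K by apply: compact_setX; exact: box_compact.
have [zs /set_mem Kzs hzs] : exists2 c, c \in K & forall t, t \in K -> h t <= h c.
  apply: compact_EVT_max => //; first by exists zb.
  exact: continuous_subspaceT.
have Qzb : Q zb = 0.
  by rewrite /Q !subrr -enorm_sqr enorm0 expr0n/= addr0.
have hb : f zb <= h zs.
  have := hzs zb (mem_set Kzb).
  by rewrite {1}/h Qzb min_r ?ler01// mulr0 subr0.
(* Outside the box the penalty is the full [theta], more than [zb] may lose, so the maximum over [K]
   is global. *)
have hall z : h z <= h zs.
  have [Kz|nK] := pselect (K z); first exact/hzs/mem_set.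
  have Qz : 1 <= Q z.
    have [h1|h1] := pselect ([set y : V | forall i,
        y ord0 i \in `[zb.1 ord0 i - 1, zb.1 ord0 i + 1]] z.1).
      rewrite /Q -[1]add0r lerD ?edot_ge0//; apply: notin_box => h2.
      by apply: nK; split.
    by rewrite /Q -[1]addr0 lerD ?edot_ge0//; exact: notin_box.
  apply: le_trans hb; rewrite /h min_l// mulr1.
  have := supf z; lra.
(* Comparison with [zb], where the penalty vanishes, shows that the truncation is inactive at
   [zs]. *)
have mQ : Num.min 1 (Q zs) <= 1 / 2.
  rewrite -(ler_pM2l th0); have := supf zs; move: hb; rewrite /h; lra.
have Qs : Num.min 1 (Q zs) = Q zs.
  by move: mQ; case: (ltP 1 (Q zs)) => // _; lra.
exists zb, zs => /=; split.
- have := supf z0; move: hb; rewrite /h Qs.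
  have : 0 <= theta * Q zs by rewrite mulr_ge0// ltW.
  lra.
- by rewrite -/(Q zs) -Qs; lra.
- by move=> z; rewrite -/(Q zs) -Qs; exact: hall.
Qed.

End PerturbedMaximum.

(** * Quadratic test functions *)

Section QuadraticTests.
Variables (R : realType) (N : nat).
Notation V := 'rV[R]_N.

Definition quad (c : R) (p : V) (K : R) (x0 y : V) : R :=
  c + edot p (y - x0) + K * edot (y - x0) (y - x0).

Lemma quad_center c p K x0 : quad c p K x0 x0 = c.
Proof.
rewrite /quad subrr -enorm_sqr enorm0 expr0n/= mulr0 addr0.
by rewrite -(scale0r 0) edotZr mul0r addr0.
Qed.

Lemma quad_shift c p K x0 z :
  quad c p K x0 (x0 + z) = c + edot p z + K * edot z z.
Proof. by rewrite /quad [x0 + z]addrC addrK. Qed.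

Lemma normr_edot_le (x y : V) : `|edot x y| <= enorm x * enorm y.
Proof.
rewrite ler_norml edot_le_enorm andbT lerNl -edotNl.
by rewrite (le_trans (edot_le_enorm _ _))// enormN.
Qed.

Lemma quad_C11 c p K x0 : C11_at (quad c p K x0) x0 p.
Proof.
exists (`|K| + 1), 1; split; first by rewrite ltr_wpDl.
split => // z _; rewrite quad_shift quad_center.
rewrite (_ : _ - _ - _ = K * edot z z); last by ring.
rewrite normrM (ger0_norm (edot_ge0 z)) enorm_sqr ler_wpM2r ?edot_ge0//.
by rewrite lerDl.
Qed.

Lemma quad_continuous_on c p K x0 A : continuous_on (quad c p K x0) A.
Proof.
move=> y _ eps eps0.
(* For |z - y| < 1 the increment is at most [B] times |z - y|; the final [+ 1] makes [B]
   positive. *)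
pose B := enorm p + `|K| * (1 + 2 * enorm (y - x0)) + 1.
have B0 : 0 < B.
  by rewrite ltr_wpDl// addr_ge0 ?mulr_ge0 ?enorm_ge0// addr_ge0// mulr_ge0// enorm_ge0.
exists (Num.min 1 (eps / B)); first by rewrite lt_min ltr01 divr_gt0.
move=> z _; rewrite lt_min => /andP[d1]; rewrite ltr_pdivlMr// => dB.
apply: le_lt_trans dB.
have -> : quad c p K x0 z - quad c p K x0 y = edot p (z - y) +
    K * (edot (z - y) (z - y) + 2 * edot (z - y) (y - x0)).
  rewrite /quad !edotE (edotC y z) (edotC x0 z) (edotC x0 y); ring.
apply: le_trans (ler_normD _ _) _; rewrite normrM.
have h1 := normr_edot_le p (z - y).
have h2 : `|edot (z - y) (z - y) + 2 * edot (z - y) (y - x0)| <=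
    enorm (z - y) * (1 + 2 * enorm (y - x0)).
  apply: le_trans (ler_normD _ _) _.
  rewrite normrM (ger0_norm (edot_ge0 _)) -enorm_sqr normr_nat.
  have h3 := normr_edot_le (z - y) (y - x0).
  have : enorm (z - y) ^+ 2 <= enorm (z - y).
    by rewrite expr2 ler_piMr ?enorm_ge0// ltW.
  lra.
have h4 := ler_wpM2l (normr_ge0 K) h2.
have h5 := enorm_ge0 (z - y).
rewrite /B; lra.
Qed.

(** The strict touching is global, so the gluing radius [r] is free; it later becomes the splitting
    point [rho] of the integrals. *)
Lemma subsol_quad s (O : set V) (u : V -> R) (x0 p : V) (K r : R) :
  subsol_nzgrad s O u -> O x0 -> p != 0 -> 0 < r ->
  (forall z, z != 0 -> u (x0 + z) < u x0 + edot p z + K * edot z z) ->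
  (0 <= frac_inf_lap s (Defs.glue u (quad (u x0) p K x0) x0 r) x0
          ((enorm p)^-1 *: p))%E.
Proof.
move=> [_ su] Ox p0 r0 hu; apply: su => //.
- exact: quad_C11.
- exact: quad_continuous_on.
- exact: quad_center.
- move=> y _ yx; have := hu (y - x0); rewrite subr_eq0 => /(_ yx).
  by rewrite addrC subrK.
Qed.

Lemma supersol_quad s (O : set V) (u : V -> R) (x0 p : V) (K r : R) :
  supersol_nzgrad s O u -> O x0 -> p != 0 -> 0 < r ->
  (forall z, z != 0 -> u x0 + edot p z + K * edot z z < u (x0 + z)) ->
  (frac_inf_lap s (Defs.glue u (quad (u x0) p K x0) x0 r) x0
          ((enorm p)^-1 *: p) <= 0)%E.
Proof.
move=> [_ su] Ox p0 r0 hu; apply: su => //.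
- exact: quad_C11.
- exact: quad_continuous_on.
- exact: quad_center.
- move=> y _ yx; have := hu (y - x0); rewrite subr_eq0 => /(_ yx).
  by rewrite [x0 + _]addrC subrK.
Qed.

End QuadraticTests.

(** * Viscosity integrals at touching points *)

Section SecondDifference.
Variables (R : realType) (N : nat) (s : R).
Hypotheses (s12 : 1 / 2 < s) (s1 : s < 1).
Notation V := 'rV[R]_N.
Notation pos := [set t : R | 0 < t].
Notation mu := (@lebesgue_measure R).

Definition lap_integrand (f : V -> R) (x v : V) (t : R) : R :=
  (f (x + t *: v) + f (x - t *: v) - 2 * f x) / t `^ (1 + 2 * s).

Lemma ler_powR_neg (e t t' : R) : e <= 0 -> 0 < t -> t <= t' -> t' `^ e <= t `^ e.
Proof.
move=> e0 t0 tt'; have t'0 := lt_le_trans t0 tt'.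
rewrite -[e]opprK !(powRN _ (- e)) lef_pV2 ?posrE ?powR_gt0//.
by apply: ge0_ler_powR; rewrite ?oppr_ge0// nnegrE ltW.
Qed.

Lemma powR_expB (a b t : R) : 0 < t -> t `^ a / t `^ b = t `^ (a - b).
Proof. by move=> t0; rewrite powRB// (gt_eqF t0) implybT. Qed.

(** Below [r] the linear parts cancel in the symmetric difference and 2 K t^2 remains, for any unit
    direction. *)
Lemma lap_integrand_glue (u : V -> R) (x p : V) (K : R) (v : V) (r t : R) :
  enorm v = 1 -> 0 < t ->
  lap_integrand (Defs.glue u (quad (u x) p K x) x r) x v t =
  if t < r then 2 * K * t `^ (1 - 2 * s) else lap_integrand u x v t.
Proof.
move=> v1 t0; rewrite /lap_integrand /Defs.glue subrr enorm0 quad_center if_same.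
rewrite !(addrC x) !addrK enormN enormZ v1 mulr1 gtr0_norm//.
case: ifP => // _; rewrite !(addrC _ x) !quad_shift !edotE -enorm_sqr v1 expr1n.
rewrite (_ : _ - 2 * u x = 2 * K * t ^+ 2); last by ring.
rewrite -mulrA -[t ^+ 2]powR_mulrn ?(ltW t0)// powR_expB//; congr (_ * _).
by congr (_ `^ _); ring.
Qed.

Variables (C : R).
Hypothesis C0 : 0 < C.
Let holds (u : V -> R) :=
  forall x y, `|u x - u y| <= C * enorm (x - y) `^ (2 * s - 1).

Let g0 : 0 < 2 * s - 1. Proof. move: s12; lra. Qed.

Lemma measurable_lap_integrand (u : V -> R) x v : holds u ->
  measurable_fun setT (lap_integrand u x v).
Proof.
move=> hu; apply: measurable_funM.
  apply: measurable_funB => //; apply: measurable_funD.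
    apply: continuous_measurable_fun; exact: (line_continuous g0 C0 hu).
  rewrite (_ : (fun t => _) = (fun t => u (x + t *: (- v)))).
    apply: continuous_measurable_fun; exact: (line_continuous g0 C0 hu).
  by apply/funext => t; rewrite scalerN.
rewrite (_ : (fun t => _) = (@powR R ^~ (- (1 + 2 * s)))).
  exact: measurable_powR.
by apply/funext => t; rewrite powRN.
Qed.

(** The numerator is at most 2 C t^(2s - 1); dividing by t^(1 + 2s) gives t^(-2) whatever s is. *)
Lemma lap_integrand_bound (u : V -> R) x v t : holds u -> enorm v = 1 -> 0 < t ->
  `|lap_integrand u x v t| <= 2 * C * t `^ (- 2).
Proof.
move=> hu v1 t0; rewrite /lap_integrand normrM normfV.
rewrite (ger0_norm (powR_ge0 _ _)) ler_pdivrMr ?powR_gt0//.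
rewrite -[2 * C * _ * _]mulrA -powRD; last by rewrite (gt_eqF t0) implybT.
rewrite (_ : - 2 + (1 + 2 * s) = 2 * s - 1); last by ring.
rewrite (_ : _ - _ = (u (x + t *: v) - u x) + (u (x - t *: v) - u x)); last by ring.
apply: le_trans (ler_normD _ _) _.
have := hu (x + t *: v) x; have := hu (x - t *: v) x.
rewrite !(addrC x) !addrK enormN enormZ v1 mulr1 (gtr0_norm t0).
lra.
Qed.

(** Near 0 the exponent 1 - 2s exceeds -1 because s < 1, and t^(-2) controls the tail. This
    finiteness allows the two integrals to be subtracted. *)
Lemma integrable_lap_glue (u : V -> R) (x p : V) (K : R) (v : V) (r : R) :
  holds u -> enorm v = 1 -> 0 < r ->
  mu.-integrable pos (EFin \o lap_integrand (Defs.glue u (quad (u x) p K x) x r) x v).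
Proof.
move=> hu v1 r0.
apply: (@le_two_powers_integrable _ (1 - 2 * s) (- 2) r (2 * `|K|) (2 * C)).
- by move: s1 s12; lra.
- by move: s1 s12; lra.
- exact: r0.
- by rewrite mulr_ge0.
- by rewrite mulr_ge0// ltW.
- pose f (t : R) := if t < r then 2 * K * t `^ (1 - 2 * s)
    else lap_integrand u x v t.
  have mf : measurable_fun pos f.
    apply: measurable_funTS; apply: measurable_fun_ifT.
    + exact: measurable_fun_ltr.
    + by apply: measurable_funM => //; exact: measurable_powR.
    + exact: measurable_lap_integrand.
  apply: eq_measurable_fun mf => t.
  by rewrite inE/= => t0; rewrite lap_integrand_glue.
- move=> t t0; rewrite lap_integrand_glue// /two_powers; case: ifP => _.
    by rewrite !normrM (ger0_norm (powR_ge0 _ _)) normr_nat.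
  exact: lap_integrand_bound.
Qed.

(* Subtracting the two viscosity inequalities. The directions [v] and [v'] of the two
   gradients may differ, at a cost of order [tau `^ (2 * s - 1)]; a drop by [d] along
   the ray [t >= L] yields the term [d * (L + 1) `^ (- (1 + 2 * s))]. *)
Lemma viscosity_comparison (u w : V -> R) (x y p q v v' : V)
    (K rho theta tau L d : R) :
  holds u -> holds w -> enorm v = 1 -> enorm v' = 1 ->
  0 < rho -> rho <= L -> 0 <= theta -> 0 <= d -> 0 <= K ->
  (0 <= frac_inf_lap s (Defs.glue u (quad (u x) p K x) x rho) x v)%E ->
  (frac_inf_lap s (Defs.glue w (quad (w y) q (- K) y) y rho) y v' <= 0)%E ->
  (forall z, u (x + z) - u x - (w (y + z) - w y) <= theta) ->
  (forall t, L <= t -> u (x + t *: v) - u x - (w (y + t *: v) - w y) <= - d) ->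
  enorm (v - v') <= tau ->
  d * (L + 1) `^ (- (1 + 2 * s)) <=
    4 * K / (2 - 2 * s) * rho `^ (2 - 2 * s) +
    (2 * theta * rho `^ (1 - 2 * s) + 2 * C * tau `^ (2 * s - 1)) / rho.
Proof.
move=> hu hw v1 v'1 rho0 rhoL th0 d0 K0 Iu Iw shift drop vtau.
have tau0 : 0 <= tau := le_trans (enorm_ge0 _) vtau.
pose Fu := lap_integrand (Defs.glue u (quad (u x) p K x) x rho) x v.
pose Fw := lap_integrand (Defs.glue w (quad (w y) q (- K) y) y rho) y v'.
(* Coefficient of t^(-2) in the tail: the defect [theta] forward and backward, and two changes of
   direction. *)
pose B := 2 * theta * rho `^ (1 - 2 * s) + 2 * C * tau `^ (2 * s - 1).
have iu : mu.-integrable pos (EFin \o Fu) by exact: integrable_lap_glue.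
have iw : mu.-integrable pos (EFin \o Fw) by exact: integrable_lap_glue.
have IB : (0 <= \int[mu]_(t in pos) ((Fu t - Fw t)%R%:E))%E.
  under eq_integral do rewrite EFinB.
  rewrite (integralB_EFin (@measurable_pos R) iu iw).
  have /fineK <- := integrable_fin_num (@measurable_pos R) iu.
  have /fineK <- := integrable_fin_num (@measurable_pos R) iw.
  rewrite -EFinB lee_fin subr_ge0.
  by apply: (@le_trans _ _ 0); [exact: fine_le0|exact: fine_ge0].
(* Cost of replacing one direction by the other: the points are at most [t * tau] apart. *)
have wdir (b b' : V) t : enorm (b - b') <= tau -> 0 < t ->
    w (y + t *: b) - w (y + t *: b') <= C * (t `^ (2 * s - 1) * tau `^ (2 * s - 1)).
  move=> btau t0; apply: le_trans (ler_norm _) _; apply: le_trans (hw _ _) _.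
  rewrite ler_pM2l// -powRM ?(ltW t0)//; apply: ge0_ler_powR.
  - exact: ltW.
  - by rewrite nnegrE enorm_ge0.
  - by rewrite nnegrE mulr_ge0// ltW.
  rewrite (_ : _ - _ = t *: (b - b')); last first.
    by rewrite scalerBr opprD addrACA subrr add0r.
  by rewrite enormZ gtr0_norm// ler_pM2l.
(* [a] bounds the forward increments, [shift] at [- (t *: v)] the backward ones; [wdir] is paid once
   for each. *)
have far t a : rho <= t -> u (x + t *: v) - u x - (w (y + t *: v) - w y) <= a ->
    Fu t - Fw t <= (a + theta) * t `^ (- (1 + 2 * s)) +
                   2 * C * tau `^ (2 * s - 1) * t `^ (- 2).
  move=> rt ha; have t0 := lt_le_trans rho0 rt.
  rewrite /Fu /Fw !lap_integrand_glue// ltNge rt/= /lap_integrand -mulrBl -powRN.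
  rewrite -(_ : t `^ (2 * s - 1) * t `^ (- (1 + 2 * s)) = t `^ (- 2)); last first.
    rewrite -powRD; last by rewrite (gt_eqF t0) implybT.
    by congr (_ `^ _); ring.
  rewrite mulrA -mulrDl ler_pM2r ?powR_gt0//.
  have := wdir (- v) (- v') t; rewrite !scalerN opprK addrC enormB => /(_ vtau t0).
  have := wdir v v' t vtau t0; have := shift (- (t *: v)).
  move: ha; lra.
have B0 : 0 <= B.
  by rewrite addr_ge0// !mulr_ge0 ?powR_ge0// ltW.
(* As 1 - 2s < 0, the factor t^(1 - 2s) is at most rho^(1 - 2s); both tail terms then share the
   power -2. *)
have conv t : rho <= t ->
    2 * theta * t `^ (- (1 + 2 * s)) <= 2 * theta * rho `^ (1 - 2 * s) * t `^ (- 2).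
  move=> rt; have t0 := lt_le_trans rho0 rt.
  rewrite -[leRHS]mulrA ler_wpM2l ?mulr_ge0//.
  rewrite (_ : - (1 + 2 * s) = (1 - 2 * s) + - 2); last by ring.
  rewrite powRD; last by rewrite (gt_eqF t0) implybT.
  by rewrite ler_wpM2r ?powR_ge0// ler_powR_neg//; move: s12; lra.
have iuw : mu.-integrable pos (EFin \o (fun t => Fu t - Fw t)).
  exact: (integrableB (@measurable_pos R) iu iw).
have := @integral_le_two_powers_gap _ (1 - 2 * s) (- 2) rho (4 * K) B _ _ rho0 _ B0
  _ L (d * (L + 1) `^ (- (1 + 2 * s))) iuw.
have -> : 1 - 2 * s + 1 = 2 - 2 * s by ring.
have -> : - 2 + 1 = - 1 :> R by ring.
rewrite opprK invr1 mulr1 powR_inv1 ?(ltW rho0)//.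
have -> : 4 * K * (rho `^ (2 - 2 * s) / (2 - 2 * s)) =
  4 * K / (2 - 2 * s) * rho `^ (2 - 2 * s) by ring.
move=> gap; rewrite -subr_ge0 -lee_fin; apply: le_trans IB _; apply: gap.
- by move: s1 s12; lra.
- by move: s1 s12; lra.
- by rewrite mulr_ge0.
- exact: lt_le_trans rhoL.
(* Below [rho] the quadratics give 2 K - (- 2 K) = 4 K; beyond it, [far] applies with
   [a = theta]. *)
- move=> t t0; rewrite /two_powers; case: ltP => rt.
    rewrite /Fu /Fw !lap_integrand_glue// rt; lra.
  apply: le_trans (far t theta rt (shift _)) _.
  have := conv t rt; rewrite /B; lra.
(* On [[L, L + 1]] the forward bound is [- d], and the weight is smallest at [L + 1]. *)
- move=> t /andP[Lt tL]; have rt := le_trans rhoL Lt.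
  have t0 := lt_le_trans rho0 rt.
  rewrite /two_powers ltNge rt/=.
  apply: le_trans (far t (- d) rt (drop t Lt)) _.
  have := conv t rt.
  have h1 : (L + 1) `^ (- (1 + 2 * s)) <= t `^ (- (1 + 2 * s)).
    by apply: ler_powR_neg => //; move: s12; lra.
  have h2 := ler_wpM2l d0 h1.
  have h3 : 0 <= theta * t `^ (- (1 + 2 * s)) by rewrite mulr_ge0 ?powR_ge0.
  rewrite /B; lra.
Qed.

End SecondDifference.

(** * Geometry of open sets inside the strip *)

Section Strip.
Variables (R : realType) (N : nat) (hN : (0 < N)%N) (O : set 'rV[R]_N) (M : R).
Hypotheses (Oop : eopen O)
  (OM : forall x, O x -> - M <= x ord0 (Ordinal hN) <= M).
Notation V := 'rV[R]_N.
Notation e := (e1 R hN).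

Lemma notin_strip (x v : V) (t : R) : O x ->
  2 * M < t * v ord0 (Ordinal hN) -> ~ O (x + t *: v).
Proof.
move=> /OM/andP[h1 h2] tM /OM; rewrite !mxE => /andP[h3 h4]; lra.
Qed.

Lemma eboundary_notin (z : V) : eboundary O z -> ~ O z.
Proof.
move=> bz /Oop[r r0 rO]; have [_ [y [yr nOy]]] := bz r r0.
exact/nOy/rO.
Qed.

(** The line through [x] along [e] meets [O] in a set of times bounded above by 2M; its supremum
    gives a boundary point. This matters because [edist] would otherwise be the infimum of the empty
    set, a default value. *)
Lemma eboundary_nonempty (x : V) : O x -> eboundary O !=set0.
Proof.
move=> Ox; pose S := [set t : R | O (x + t *: e)].
have S0 : S 0 by rewrite /S/= scale0r addr0.
have hs : has_sup S.
  split; first by exists 0.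
  exists (2 * M) => t St; rewrite leNgt; apply/negP => tM.
  by apply: (notin_strip Ox _ St); rewrite mxE/= mulr1.
exists (x + sup S *: e) => r r0; split.
- have r2 : 0 < r / 2 by lra.
  have [t St tS] := sup_adherent r2 hs.
  exists (x + t *: e); split => //; rewrite /eball/=.
  have tS' : t <= sup S by apply: ub_le_sup => //; exact: hs.2.
  rewrite opprD addrACA subrr add0r -scalerBl enormZ enorm_e1 mulr1.
  by rewrite ltr_norml; apply/andP; split; lra.
- exists (x + (sup S + r / 2) *: e); split; rewrite /eball/=.
    rewrite opprD addrACA subrr add0r -scalerBl enormZ enorm_e1 mulr1.
    by rewrite addrAC subrr add0r ger0_norm; lra.
  move=> St; have : sup S + r / 2 <= sup S by apply: ub_le_sup => //; exact: hs.2.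
  lra.
Qed.

(** The boundary of an open set lies in its complement. *)
Lemma edist_ge (x : V) (k : R) : O x ->
  (forall z, ~ O z -> k <= enorm (x - z)) -> k <= Defs.edist x (eboundary O).
Proof.
move=> Ox kO; apply: lb_le_inf.
  by have [z bz] := eboundary_nonempty Ox; exists (enorm (x - z)), z.
by move=> _ [z bz <-]; exact/kO/eboundary_notin.
Qed.

End Strip.

(** * Doubling of variables with a penalty *)

Section DoublingPoint.
Variables (R : realType) (N : nat) (u w : 'rV[R]_N -> R).
Notation V := 'rV[R]_N.

(** The penalty is truncated at the competitor [(x, y)] only: at [(xs, ys)] it equals its
    truncation, as [Q xs ys <= 1]. *)
Definition doubling_point (k theta : R) (xs ys xb yb : V) : Prop :=
  let Q (x y : V) := edot (x - xb) (x - xb) + edot (y - yb) (y - yb) in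
  Q xs ys <= 1 /\
  forall x y, u x - w y - k * edot (x - y) (x - y) - theta * Num.min 1 (Q x y) <=
    u xs - w ys - k * edot (xs - ys) (xs - ys) - theta * Q xs ys.

(** [perturbed_max] applies since the doubled function is bounded above: with t = |x - y|, C t^g <=
    C + k t^2, because t^g <= 1 for t <= 1 and t^g <= t^2 for t > 1. *)
Lemma doubling_point_exists (g C B k theta : R) (x0 : V) :
  0 < g -> g < 1 -> 0 < C -> 0 <= B -> C + B < k -> 0 < theta ->
  (forall x y, `|u x - u y| <= C * enorm (x - y) `^ g) ->
  (forall x y, `|w x - w y| <= C * enorm (x - y) `^ g) ->
  (forall x, u x - w x <= B) ->
  exists xs ys xb yb, doubling_point k theta xs ys xb yb /\
    u x0 - w x0 - theta <= u xs - w ys - k * edot (xs - ys) (xs - ys).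
Proof.
move=> g0 g1 C0 B0 kCB th0 hu hw uwB.
pose f (z : V * V) := u z.1 - w z.2 - k * edot (z.1 - z.2) (z.1 - z.2).
have cu := holder_continuous g0 C0 hu.
have cw := holder_continuous g0 C0 hw.
have cf : continuous f.
  move=> z; apply: (@continuousB R R (V * V)%type).
    apply: (@continuousB R R (V * V)%type).
    - by apply: (@continuous_comp _ V R fst u); [exact: cvg_fst|exact: cu].
    - by apply: (@continuous_comp _ V R snd w); [exact: cvg_snd|exact: cw].
  apply: (@continuousM R (V * V)%type); first exact: cst_continuous.
  apply: (@continuous_comp (V * V)%type V R (fun z : V * V => z.1 - z.2)
    (fun x : V => edot x x)).
    by apply: (@continuousB R V (V * V)%type); [exact: cvg_fst|exact: cvg_snd].
  exact: edot_sqr_continuous.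
have fB z : f z <= B + C.
  have := hw z.1 z.2; rewrite ler_norml => /andP[_ h].
  have := uwB z.1; rewrite /f -enorm_sqr.
  set t := enorm _ in h *; have t0 : 0 <= t := enorm_ge0 _.
  have h1 : C * t `^ g <= C + k * t ^+ 2.
    have [t1|t1] := leP t 1.
      apply: (@le_trans _ _ C); last by rewrite lerDl mulr_ge0 ?sqr_ge0//; lra.
      rewrite ler_piMr ?(ltW C0)//.
      have := @ge0_ler_powR R g (ltW g0) t 1; rewrite !nnegrE powR1; exact.
    apply: (@le_trans _ _ (C * t ^+ 2)); last first.
      by rewrite -[leLHS]add0r lerD ?(ltW C0)// ler_wpM2r ?sqr_ge0//; lra.
    rewrite ler_pM2l// (le_trans (ler1_powR (ltW t1) (ltW g1)))//.
    by rewrite expr2 ler_peMr// ltW.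
  lra.
have [[xb yb] [[xs ys] [/= h1 h2 h3]]] := perturbed_max (x0, x0) cf fB th0.
exists xs, ys, xb, yb; split; first by split => // x y; exact: (h3 (x, y)).
by move: h1; rewrite /f/= subrr -enorm_sqr enorm0 expr0n/= mulr0 subr0.
Qed.

Variables (k theta : R) (xs ys xb yb : V).
Hypotheses (k0 : 0 <= k) (th0 : 0 <= theta).
Hypothesis dbl : doubling_point k theta xs ys xb yb.
(** [p] is the gradient in x at the maximum point of coupling plus penalty, and [q] is minus their
    gradient in y. *)
Let p : V := (2 * k) *: (xs - ys) + (2 * theta) *: (xs - xb).
Let q : V := (2 * k) *: (xs - ys) - (2 * theta) *: (ys - yb).

(** Freeze [ys], move only x, and bound the truncated penalty by the full quadratic, which expands
    exactly. *)
Lemma doubling_touch_above (z : V) :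
  u (xs + z) <= u xs + edot p z + (k + theta) * edot z z.
Proof.
have [_ /(_ (xs + z) ys)] := dbl.
set Q := (X in theta * Num.min 1 X); move=> h.
have : theta * Num.min 1 Q <= theta * Q by rewrite ler_wpM2l// ge_min lexx orbT.
move: h; rewrite /Q /p !edotE.
rewrite ?(edotC z xs) ?(edotC z ys) ?(edotC z xb) ?(edotC z yb).
rewrite ?(edotC ys xs) ?(edotC xb xs) ?(edotC yb ys).
lra.
Qed.

Lemma doubling_touch_below (z : V) :
  w ys + edot q z - (k + theta) * edot z z <= w (ys + z).
Proof.
have [_ /(_ xs (ys + z))] := dbl.
set Q := (X in theta * Num.min 1 X); move=> h.
have : theta * Num.min 1 Q <= theta * Q by rewrite ler_wpM2l// ge_min lexx orbT.
move: h; rewrite /Q /q !edotE.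
rewrite ?(edotC z xs) ?(edotC z ys) ?(edotC z xb) ?(edotC z yb).
rewrite ?(edotC ys xs) ?(edotC xb xs) ?(edotC yb ys).
lra.
Qed.

(** A common shift preserves [xs - ys], so the coupling cancels and only the penalty, at most
    [theta], is left. *)
Lemma doubling_shift (z : V) :
  u (xs + z) - u xs - (w (ys + z) - w ys) <= theta.
Proof.
have [_ /(_ (xs + z) (ys + z))] := dbl.
set Q := (X in theta * Num.min 1 X).
have -> : xs + z - (ys + z) = xs - ys by rewrite opprD addrACA subrr addr0.
have : theta * Num.min 1 Q <= theta * 1 by rewrite ler_wpM2l// ge_min lexx.
have : 0 <= theta * (edot (xs - xb) (xs - xb) + edot (ys - yb) (ys - yb)).
  by rewrite mulr_ge0// addr_ge0 ?edot_ge0.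
lra.
Qed.

Lemma doubling_dist_base : enorm (xs - xb) <= 1 /\ enorm (ys - yb) <= 1.
Proof.
have [+ _] := dbl; have := edot_ge0 (xs - xb); have := edot_ge0 (ys - yb).
rewrite -!enorm_sqr => h1 h2 h3.
by split; rewrite -(@expr_le1 _ 2) ?enorm_ge0//; lra.
Qed.

(** The large terms in [k] cancel; two vectors of norm at most [2 * theta] remain. *)
Lemma doubling_gradB : enorm (p - q) <= 4 * theta.
Proof.
have [h1 h2] := doubling_dist_base.
rewrite /p /q opprB [X in enorm X]addrC addrA subrK.
apply: le_trans (ler_enormD _ _) _; rewrite !enormZ ger0_norm ?mulr_ge0//.
have := ler_wpM2l th0 h1; have := ler_wpM2l th0 h2; lra.
Qed.

Lemma doubling_grad_bound :
  enorm p <= 2 * k * enorm (xs - ys) + 2 * theta.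
Proof.
have [h1 h2] := doubling_dist_base.
apply: le_trans (ler_enormD _ _) _; rewrite !enormZ !ger0_norm ?mulr_ge0//.
by rewrite lerD2l ler_piMr ?mulr_ge0.
Qed.

End DoublingPoint.

(** * Estimates at the doubling point *)

Section Comparison.
Variables (R : realType) (N : nat) (hN : (0 < N)%N) (O : set 'rV[R]_N) (M : R).
Hypotheses (Oop : eopen O)
  (OM : forall x, O x -> - M <= x ord0 (Ordinal hN) <= M) (M0 : 0 < M).
Variables (u w : 'rV[R]_N -> R) (s C : R).
Hypotheses (s12 : 1 / 2 < s) (s1 : s < 1) (C0 : 0 < C).
Notation g := (2 * s - 1).
Hypothesis hu : forall x y, `|u x - u y| <= C * enorm (x - y) `^ g.
Hypothesis hw : forall x y, `|w x - w y| <= C * enorm (x - y) `^ g.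
Hypothesis uw : forall x, ~ O x -> u x <= w x.
Notation V := 'rV[R]_N.
Notation e := (e1 R hN).
Notation i1 := (Ordinal hN).

Let g0 : 0 < g. Proof. by move: s12; lra. Qed.
Let g1 : g < 1. Proof. by move: s1; lra. Qed.

Lemma holder_le (f : V -> R) (x y : V) (t : R) :
  (forall x y, `|f x - f y| <= C * enorm (x - y) `^ g) ->
  enorm (x - y) <= t -> f x - f y <= C * t `^ g.
Proof.
move=> hf xyt; apply: le_trans (ler_norm _) _; apply: le_trans (hf _ _) _.
have t0 : 0 <= t := le_trans (enorm_ge0 _) xyt.
by rewrite ler_pM2l// ge0_ler_powR ?nnegrE ?enorm_ge0// ltW.
Qed.

(** A shift of length 2M + 1 along [e] leaves the strip, where [u <= w]; the Holder bounds carry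
    this back. *)
Lemma difference_bound : exists2 B, 0 <= B & forall x, u x - w x <= B.
Proof.
exists (2 * C * (2 * M + 1) `^ g).
  by rewrite !mulr_ge0 ?powR_ge0// ltW.
move=> x; have [Ox|/uw h] := pselect (O x); last first.
  apply: (@le_trans _ _ 0); first by lra.
  by rewrite !mulr_ge0 ?powR_ge0// ltW.
pose z := x + (2 * M + 1) *: e.
have nOz : ~ O z by apply: (notin_strip OM Ox); rewrite mxE/= mulr1; lra.
have xz : enorm (x - z) <= 2 * M + 1.
  rewrite /z opprD addrA subrr sub0r enormN enormZ enorm_e1 mulr1 ger0_norm//.
  by move: M0; lra.
have := holder_le hu xz; move: xz; rewrite enormB => /(holder_le hw).
have := uw nOz; lra.
Qed.

(** With t = |xs - ys|, the near-maximality gives k t^2 <= B + C t^g, which fails for t > kappa; the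
    cases t <= 1 and t > 1 differ in how t^g is bounded. *)
Lemma doubling_dist (k B kappa d : R) (xs ys : V) :
  0 <= d -> 0 <= B -> 0 < kappa -> kappa <= 1 -> (forall x, u x - w x <= B) ->
  B + 2 * C <= k * kappa ^+ 2 ->
  d <= u xs - w ys - k * edot (xs - ys) (xs - ys) ->
  enorm (xs - ys) <= kappa.
Proof.
move=> d0 B0 ka0 ka1 uwB hk; rewrite -enorm_sqr => hd.
have hB := uwB xs; have := holder_le hw (lexx (enorm (xs - ys))).
have := enorm_ge0 (xs - ys); move: hd; set t := enorm (xs - ys).
move=> hd t0 ht; rewrite leNgt; apply/negP => kat.
have kt : k * t ^+ 2 <= B + C * t `^ g by lra.
have k0 : 0 < k.
  by rewrite -(@pmulr_lgt0 _ (kappa ^+ 2)) ?exprn_gt0//; move: C0; lra.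
have [t1|t1] := leP t 1.
- have h1 : C * t `^ g <= C.
    rewrite ler_piMr ?(ltW C0)//.
    have := @ge0_ler_powR R g (ltW g0) t 1; rewrite !nnegrE powR1; exact.
  have h2 : k * kappa ^+ 2 <= k * t ^+ 2.
    by rewrite ler_pM2l// ler_sqr ?nnegrE// ltW.
  by move: C0; lra.
- have h1 : C * t `^ g <= C * t ^+ 2.
    rewrite ler_pM2l// (le_trans (ler1_powR (ltW t1) (ltW g1)))//.
    by rewrite expr2 ler_peMr// ltW.
  have h2 : k * kappa ^+ 2 <= k.
    by rewrite ler_piMr ?(ltW k0)// expr_le1 ?(ltW ka0).
  have t21 : 1 <= t ^+ 2 by rewrite expr_ge1// ltW.
  have h3 : B <= B * t ^+ 2 by rewrite ler_peMr.
  have h4 : (B + 2 * C) * t ^+ 2 <= k * t ^+ 2 by rewrite ler_pM2r ?exprn_gt0; lra.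
  have h5 : 0 < C * t ^+ 2 by rewrite mulr_gt0 ?exprn_gt0//; lra.
  lra.
Qed.

(** A point outside [O] within [2 * kappa] of both [xs] and [ys] would give
    [u xs - w ys <= d / 4]. *)
Lemma doubling_interior (d kappa : R) (xs ys z : V) :
  0 < d -> C * (2 * kappa) `^ g <= d / 8 -> d / 2 <= u xs - w ys ->
  enorm (xs - ys) <= kappa -> ~ O z ->
  kappa < enorm (xs - z) /\ kappa < enorm (ys - z).
Proof.
move=> d0 hk hd xyk /uw uwz.
have h : enorm (xs - z) <= 2 * kappa -> enorm (z - ys) <= 2 * kappa -> False.
  by move=> /(holder_le hu) h1 /(holder_le hw) h2; lra.
have ka0 : 0 <= kappa := le_trans (enorm_ge0 _) xyk.
split; rewrite ltNge; apply/negP => h1; apply: h => //.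
- by lra.
- rewrite (le_trans (ler_enorm_tri xs _ _))// (enormB z xs); lra.
- rewrite (le_trans (ler_enorm_tri ys _ _))//; lra.
- rewrite (enormB z ys); lra.
Qed.

Lemma monotone_grad_above (alpha beta h0 h K : R) (x p : V) :
  (forall x h, O x -> 0 < h -> h < Num.min (Defs.edist x (eboundary O)) h0 ->
    u x + beta * h `^ alpha <= u (x + h *: e)) ->
  O x -> 0 < h -> h < h0 -> h < Defs.edist x (eboundary O) ->
  (forall z, u (x + z) <= u x + edot p z + K * edot z z) ->
  beta * h `^ alpha <= h * p ord0 i1 + K * h ^+ 2.
Proof.
move=> mono Ox hpos hh0 hd touch.
have := mono x h Ox hpos; rewrite lt_min hd hh0 => /(_ isT).
have := touch (h *: e); rewrite !edotE edot_e1 -enorm_sqr enorm_e1 expr1n; lra.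
Qed.

(** Touching from below bounds [w] from below, so the monotone step must end at [y] and start at
    [y - h *: e]. *)
Lemma monotone_grad_below (alpha beta h0 h K : R) (y q : V) :
  (forall x h, O x -> 0 < h -> h < Num.min (Defs.edist x (eboundary O)) h0 ->
    w x + beta * h `^ alpha <= w (x + h *: e)) ->
  0 < h -> h < h0 ->
  O (y - h *: e) -> h < Defs.edist (y - h *: e) (eboundary O) ->
  (forall z, w y + edot q z - K * edot z z <= w (y + z)) ->
  beta * h `^ alpha <= h * q ord0 i1 + K * h ^+ 2.
Proof.
move=> mono hpos hh0 Oy hd touch.
have := mono _ h Oy hpos; rewrite lt_min hd hh0 subrK => /(_ isT).
have := touch (- (h *: e)).
rewrite !edotE edot_e1 -enorm_sqr enorm_e1 expr1n; lra.
Qed.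

(** Monotonicity bounds the first coordinate of one gradient below by [2 * c]; as |p - q| <= 4 theta
    <= c, the other keeps [c]. *)
Lemma doubling_gradient (alpha beta h0 h k theta kappa c : R) (xs ys xb yb : V) :
  0 <= theta -> 4 * theta <= c -> 0 < h -> h < h0 -> 2 * h < kappa ->
  (k + theta) * h ^+ 2 + 2 * (h * c) <= beta * h `^ alpha ->
  doubling_point u w k theta xs ys xb yb -> O xs ->
  (forall z, ~ O z -> kappa < enorm (xs - z) /\ kappa < enorm (ys - z)) ->
  (forall x h, O x -> 0 < h -> h < Num.min (Defs.edist x (eboundary O)) h0 ->
    u x + beta * h `^ alpha <= u (x + h *: e)) \/
  (forall x h, O x -> 0 < h -> h < Num.min (Defs.edist x (eboundary O)) h0 ->
    w x + beta * h `^ alpha <= w (x + h *: e)) ->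
  let p := (2 * k) *: (xs - ys) + (2 * theta) *: (xs - xb) in
  let q := (2 * k) *: (xs - ys) - (2 * theta) *: (ys - yb) in
  c <= p ord0 i1 /\ c <= q ord0 i1.
Proof.
move=> th0 thc hp hh0 hkap hc dbl Oxs int mono p q.
have above := doubling_touch_above th0 dbl.
have below := doubling_touch_below th0 dbl.
have pq : enorm (p - q) <= 4 * theta := doubling_gradB th0 dbl.
have pq1 : `|p ord0 i1 - q ord0 i1| <= 4 * theta.
  by have := le_coord_enorm (p - q) i1; rewrite !mxE => /le_trans; apply.
have grad (v : R) : beta * h `^ alpha <= h * v + (k + theta) * h ^+ 2 -> 2 * c <= v.
  by move=> hv; rewrite -(ler_pM2l hp); lra.
suff [?|?] : 2 * c <= p ord0 i1 \/ 2 * c <= q ord0 i1.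
- by move: pq1; rewrite ler_norml; lra.
- by move: pq1; rewrite ler_norml; lra.
case: mono => mono.
- left; apply: grad; apply: (monotone_grad_above mono Oxs hp hh0 _ above).
  apply: (@lt_le_trans _ _ kappa); first lra.
  by apply: (edist_ge Oop OM Oxs) => z /int[/ltW].
- have Oyh : O (ys - h *: e).
    apply: contrapT => /int[_]; rewrite subKr.
    by rewrite enormZ enorm_e1 mulr1 gtr0_norm//; lra.
  right; apply: grad; apply: (monotone_grad_below mono hp hh0 Oyh _ below).
  (* The step back by [h] costs [h] of the distance [kappa], hence the condition [2 * h < kappa]. *)
  apply: (@lt_le_trans _ _ (kappa - h)); first lra.
  apply: (edist_ge Oop OM Oyh) => z /int[_].
  have := ler_enorm_tri (ys - h *: e) ys z.
  by rewrite subKr enormZ enorm_e1 mulr1 (gtr0_norm hp); lra.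
Qed.

(** Instance of [viscosity_comparison] with coefficient [k + 2], which exceeds [k + theta] and so
    makes the touching strict, with drop [d / 4] and [tau = 8 * theta / c]. *)
Lemma doubling_viscosity (k theta kappa c d rho L : R) (xs ys xb yb : V) :
  subsol_nzgrad s O u -> supersol_nzgrad s O w ->
  0 < k -> 0 <= theta -> theta <= 1 -> 0 < c -> 0 < d -> 0 < rho -> rho <= L ->
  kappa <= 1 -> C * kappa `^ g <= d / 8 -> (2 * M + 1) * (2 * k + 2) / c <= L ->
  doubling_point u w k theta xs ys xb yb -> O xs -> O ys ->
  enorm (xs - ys) <= kappa -> d / 2 <= u xs - w ys ->
  let p := (2 * k) *: (xs - ys) + (2 * theta) *: (xs - xb) in
  let q := (2 * k) *: (xs - ys) - (2 * theta) *: (ys - yb) in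
  c <= p ord0 i1 -> c <= q ord0 i1 ->
  d / 4 * (L + 1) `^ (- (1 + 2 * s)) <=
    4 * (k + 2) / (2 - 2 * s) * rho `^ (2 - 2 * s) +
    (2 * theta * rho `^ (1 - 2 * s) + 2 * C * (8 * theta / c) `^ g) / rho.
Proof.
move=> subu supw k0 th0 th1 c0 d0 rho0 rhoL kp1 hk1 hL dbl Oxs Oys xyk uwd p q p1 q1.
have above := doubling_touch_above th0 dbl.
have below := doubling_touch_below th0 dbl.
have pq : enorm (p - q) <= 4 * theta := doubling_gradB th0 dbl.
have pc : c <= enorm p.
  by apply: le_trans (le_coord_enorm p i1); apply: le_trans (ler_norm _).
have qc : c <= enorm q.
  by apply: le_trans (le_coord_enorm q i1); apply: le_trans (ler_norm _).
have np : p != 0 by rewrite -enorm_gt0 (lt_le_trans c0).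
have nq : q != 0 by rewrite -enorm_gt0 (lt_le_trans c0).
have pk : enorm p <= 2 * k + 2.
  apply: le_trans (doubling_grad_bound (ltW k0) th0 dbl) _.
  have : k * enorm (xs - ys) <= k * 1 by rewrite ler_pM2l// (le_trans xyk).
  lra.
have k20 : 0 < 2 * k + 2 by lra.
apply: (@viscosity_comparison R N s s12 s1 C C0 u w xs ys p q
  ((enorm p)^-1 *: p) ((enorm q)^-1 *: q)) => //.
- exact: enorm_normalize.
- exact: enorm_normalize.
- lra.
- lra.
- apply: (subsol_quad subu) => // z z0; apply: le_lt_trans (above z) _.
  by rewrite ltrD2l ltr_pM2r -?enorm_sqr ?exprn_gt0 ?enorm_gt0//; lra.
- apply: (supersol_quad supw) => // z z0; apply: lt_le_trans (below z).
  by rewrite -mulNr ltrD2l ltr_pM2r -?enorm_sqr ?exprn_gt0 ?enorm_gt0//; lra.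
- exact: doubling_shift th0 dbl.
(* The first coordinate of [v] is at least c / (2k + 2), so at time [L] the ray has moved by 2M + 1.
   There [u <= w], and exchanging [xs] for [ys] in [w] costs at most [d / 8], against a start of at
   least [d / 2]. *)
- move=> t Lt; set v := _ *: p.
  have nO : ~ O (xs + t *: v).
    apply: (notin_strip OM Oxs); rewrite mxE.
    apply: (@lt_le_trans _ _ (2 * M + 1)); first by lra.
    have -> : 2 * M + 1 = (2 * M + 1) * (2 * k + 2) / c * ((2 * k + 2)^-1 * c).
      by field; rewrite !gt_eqF.
    apply: ler_pM.
    + by rewrite divr_ge0 ?mulr_ge0 ?(ltW c0) ?(ltW k20)//; move: M0; lra.
    + by rewrite mulr_ge0 ?invr_ge0 ?(ltW c0) ?(ltW k20).
    + exact: le_trans Lt.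
    + apply: ler_pM => //; [by rewrite invr_ge0 ltW|exact: ltW|].
      by rewrite lef_pV2 ?posrE// enorm_gt0.
  have := uw nO.
  have : w (xs + t *: v) - w (ys + t *: v) <= C * kappa `^ g.
    by apply: (holder_le hw); rewrite opprD addrACA subrr addr0.
  lra.
- apply: le_trans (enorm_normalizeB np nq) _.
  apply: ler_pM; rewrite ?mulr_ge0 ?invr_ge0 ?enorm_ge0//; first by lra.
  by rewrite lef_pV2 ?posrE ?enorm_gt0.
Qed.

End Comparison.

(** * Choice of the constants and contradiction *)

Theorem theorem4p15 (R : realType) (N : nat) (hN : (0 < N)%N) (s : R)
  (Omega : set 'rV[R]_N) (u w : 'rV[R]_N -> R) (alpha : R) :
  1 / 2 < s -> s < 1 ->
  eopen Omega ->
  (exists M : R, 0 < M /\ forall x, Omega x ->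
      - M <= x ord0 (Ordinal hN) <= M) ->
  subsol_nzgrad s Omega u ->
  supersol_nzgrad s Omega w ->
  (forall x, ~ Omega x -> u x <= w x) ->
  holder (2 * s - 1) u -> holder (2 * s - 1) w ->
  alpha < 2 ->
  (unif_monotone hN Omega alpha u \/ unif_monotone hN Omega alpha w) ->
  forall x, Omega x -> u x <= w x.
Proof.
move=> s12 s1 Oop [M [M0 OM]] subu supw uw holu holw al2 mono x0 Ox0.
have g0 : 0 < 2 * s - 1 by lra.
have g1 : 2 * s - 1 < 1 by lra.
have [Cu Cu0 hu'] := holder_bound g0 holu.
have [Cw Cw0 hw'] := holder_bound g0 holw.
pose C := Num.max Cu Cw.
have C0 : 0 < C by rewrite lt_max Cu0.
have hu x y : `|u x - u y| <= C * enorm (x - y) `^ (2 * s - 1).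
  by apply: le_trans (hu' _ _) _; rewrite ler_wpM2r ?powR_ge0// le_max lexx.
have hw x y : `|w x - w y| <= C * enorm (x - y) `^ (2 * s - 1).
  by apply: le_trans (hw' _ _) _; rewrite ler_wpM2r ?powR_ge0// le_max lexx orbT.
have [B B0 uwB] := difference_bound OM M0 s12 C0 hu hw uw.
rewrite leNgt; apply/negP => wu.
pose d := u x0 - w x0; have d0 : 0 < d by rewrite /d; lra.
have d8 : 0 < d / 8 by lra.
have [kappa2 /andP[ka0 ka1] hkappa] := powR_small C0 g0 d8.
(* Halved so that the Holder error is at most [d / 8] at [2 * kappa] as well. *)
pose kappa := kappa2 / 2.
have kp : 0 < kappa by rewrite /kappa; lra.
have kp1 : kappa <= 1 by rewrite /kappa; lra.
have hk2 : C * (2 * kappa) `^ (2 * s - 1) <= d / 8 by apply: hkappa; rewrite /kappa; lra.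
have hk1 : C * kappa `^ (2 * s - 1) <= d / 8 by apply: hkappa; rewrite /kappa; lra.
(* This penalisation forces |xs - ys| <= kappa; since [kappa <= 1], it also exceeds [C + B]. *)
pose k := (B + 2 * C) / kappa ^+ 2.
have kk : B + 2 * C <= k * kappa ^+ 2 by rewrite divfK// gt_eqF// exprn_gt0.
have kBC : C + B < k.
  apply: (@lt_le_trans _ _ (B + 2 * C)); first by lra.
  by rewrite ler_peMr ?invf_ge1 ?exprn_gt0 ?expr_le1 ?(ltW kp)//; lra.
have k0 : 0 < k by lra.
pose K := k + 2.
have K0 : 0 < K by rewrite /K; lra.
have [beta [h0 [be0 [h00 mono']]]] : exists beta h0 : R, 0 < beta /\ 0 < h0 /\
  ((forall x h, Omega x -> 0 < h ->
      h < Num.min (Defs.edist x (eboundary Omega)) h0 ->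
      u x + beta * h `^ alpha <= u (x + h *: e1 R hN)) \/
   (forall x h, Omega x -> 0 < h ->
      h < Num.min (Defs.edist x (eboundary Omega)) h0 ->
      w x + beta * h `^ alpha <= w (x + h *: e1 R hN))).
  case: mono => -[beta [h0 [? [? ?]]]]; exists beta, h0; split => //; split => //.
    by left.
  by right.
have al0 : 0 < 2 - alpha by lra.
have be2 : 0 < beta / 2 by lra.
have [hh /andP[hh0 _] hK] := powR_small K0 al0 be2.
(* Up to [hh] the quadratic error takes at most half of beta h^alpha; the other bounds keep the step
   inside [Omega] and below [h0]. *)
pose h := Num.min hh (Num.min (kappa / 3) (h0 / 2)).
have hp : 0 < h by rewrite !lt_min hh0 !divr_gt0.
have hhh : h <= hh by rewrite ge_min lexx.
have hkap : 2 * h < kappa.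
  have : h <= kappa / 3 by rewrite !ge_min lexx !orbT.
  by clear - kp; lra.
have hh2 : h < h0.
  have : h <= h0 / 2 by rewrite !ge_min lexx !orbT.
  by clear - h00; lra.
(* Makes [2 * (h * c)] the remaining half of beta h^alpha; [c] is fixed before [theta]. *)
pose c := beta / 4 * h `^ alpha / h.
have c0 : 0 < c by rewrite !divr_gt0 ?mulr_gt0 ?divr_gt0 ?powR_gt0.
(* since [alpha < 2], the drift [h ^ alpha] beats the quadratic error [K h^2] *)
have hab theta : theta <= 1 ->
    (k + theta) * h ^+ 2 + 2 * (h * c) <= beta * h `^ alpha.
  move=> th1.
  have h1 : (k + theta) * h ^+ 2 <= K * h ^+ 2.
    by rewrite ler_wpM2r ?sqr_ge0// lerD2l (le_trans th1)// ler1n.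
  have h2 : K * h ^+ 2 <= beta / 2 * h `^ alpha.
    have -> : h ^+ 2 = h `^ (2 - alpha) * h `^ alpha.
      by rewrite -powRD ?subrK ?powR_mulrn ?(ltW hp)// (gt_eqF hp) implybT.
    by rewrite mulrA ler_pM2r ?powR_gt0// hK// (ltW hp) hhh.
  have h3 : h * c = beta / 4 * h `^ alpha by rewrite mulrC divfK// gt_eqF.
  by clear - h1 h2 h3; lra.
pose L := (2 * M + 1) * (2 * k + 2) / c.
have L0 : 0 < L by rewrite divr_gt0// mulr_gt0// addr_gt0// mulr_gt0.
(* The gain from outside the strip, fixed before [rho] and [theta]: each of three errors is made at
   most [m / 4]. *)
pose m := d / 4 * (L + 1) `^ (- (1 + 2 * s)).
have m0 : 0 < m by rewrite mulr_gt0 ?divr_gt0// powR_gt0// addr_gt0.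
have m4 : 0 < m / 4 by rewrite divr_gt0.
have s22 : 0 < 2 - 2 * s by clear - s1; lra.
have Ks0 : 0 < 4 * K / (2 - 2 * s) by rewrite divr_gt0// mulr_gt0.
have [r1 /andP[r10 _] hr1] := powR_small Ks0 s22 m4.
pose rho := Num.min r1 L.
have rho0 : 0 < rho by rewrite lt_min r10.
have rhoL : rho <= L by rewrite ge_min lexx orbT.
have hrho : 4 * K / (2 - 2 * s) * rho `^ (2 - 2 * s) <= m / 4.
  by apply: hr1; rewrite (ltW rho0) ge_min lexx.
have Cr0 : 0 < 2 * C / rho by rewrite divr_gt0// mulr_gt0.
have [t1 /andP[t10 _] ht1] := powR_small Cr0 g0 m4.
pose A := 2 * rho `^ (1 - 2 * s) / rho.
have A0 : 0 < A by rewrite /A divr_gt0// mulr_gt0// powR_gt0.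
(* In order: [theta <= 1], a value of at least [d / 2] at the maximum, gradients within [c], small
   direction error, small shift error. *)
pose theta := Num.min (Num.min 1 (d / 2))
  (Num.min (c / 4) (Num.min (t1 * c / 8) (m / 4 / A))).
have th0 : 0 < theta.
  have tc : 0 < t1 * c / 8 by rewrite divr_gt0// mulr_gt0.
  have [d2 c4] : 0 < d / 2 /\ 0 < c / 4 by split; rewrite divr_gt0.
  by rewrite !lt_min ltr01 d2 c4 tc (divr_gt0 m4 A0).
have th1 : theta <= 1 by rewrite !ge_min lexx.
have thd : theta <= d / 2 by rewrite !ge_min lexx !orbT.
have thc : 4 * theta <= c.
  by rewrite mulrC -ler_pdivlMr// !ge_min lexx !orbT.
have tht : theta <= t1 * c / 8 by rewrite !ge_min lexx !orbT.
have thA : theta <= m / 4 / A by rewrite !ge_min lexx !orbT.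
have [xs [ys [xb [yb [dbl hmax]]]]] :=
  doubling_point_exists x0 g0 g1 C0 B0 kBC th0 hu hw uwB.
have hd2 : d / 2 <= u xs - w ys - k * edot (xs - ys) (xs - ys).
  by apply: le_trans hmax; rewrite -/d; clear - thd; lra.
have d20 : 0 <= d / 2 by rewrite divr_ge0// ltW.
have xyk : enorm (xs - ys) <= kappa.
  exact: (doubling_dist s12 s1 C0 hw d20 B0 kp kp1 uwB kk hd2).
have uwd : d / 2 <= u xs - w ys.
  by apply: le_trans hd2 _; rewrite gerBl mulr_ge0 ?edot_ge0// ltW.
have int z : ~ Omega z -> kappa < enorm (xs - z) /\ kappa < enorm (ys - z).
  exact: (doubling_interior s12 C0 hu hw uw d0 hk2 uwd xyk).
have Oxs : Omega xs.
  by apply: contrapT => /int[+ _]; rewrite subrr enorm0 ltNge (ltW kp).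
have Oys : Omega ys.
  by apply: contrapT => /int[_]; rewrite subrr enorm0 ltNge (ltW kp).
have [p1 q1] := doubling_gradient Oop OM (ltW th0) thc hp hh2 hkap (hab _ th1) dbl
  Oxs int mono'.
have := doubling_viscosity OM M0 s12 s1 C0 hu hw uw subu supw k0 (ltW th0) th1 c0 d0
  rho0 rhoL kp1 hk1 (lexx L) dbl Oxs Oys xyk uwd p1 q1.
(* The inequality now bounds [m] by three errors of at most [m / 4] each. *)
rewrite -/m -/K [X in _ + X]mulrDl.
have : 2 * theta * rho `^ (1 - 2 * s) / rho <= m / 4.
  move: thA; rewrite ler_pdivlMr// /A => thA.
  by rewrite (_ : _ / rho = theta * (2 * rho `^ (1 - 2 * s) / rho))//; ring.
have : 2 * C * (8 * theta / c) `^ (2 * s - 1) / rho <= m / 4.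
  rewrite mulrAC; apply: ht1; apply/andP; split.
    by apply: divr_ge0 (ltW c0); rewrite mulr_ge0 ?(ltW th0).
  by rewrite ler_pdivrMr// [8 * theta]mulrC -ler_pdivlMr.
by clear - m0 hrho; lra.
Qed.
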